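(* Let $N$ be a finite set. Let $u_1,u_2,u_3,v_1,\dots,v_m$ ($m\ge1$) be distinct elementary imsets over $N$ and let $\alpha_1,\alpha_2,\alpha_3,\beta_1,\dots,\beta_m$ be positive integers with $$\alpha_1u_1+\alpha_2u_2+\alpha_3u_3=\beta_1v_1+\dots+\beta_mv_m .\qquad(\ast)$$ Then one of the following two properties holds. 1. $m=3$, $\alpha_1=\alpha_2=\alpha_3=\beta_1=\beta_2=\beta_3$, and (up to the order of the terms on each side) the relation $(\ast)$ is a positive multiple of $$u_{\langle a,b_1|b_2C\rangle}+u_{\langle a,b_2|b_3C\rangle}+u_{\langle a,b_3|b_1C\rangle}=u_{\langle a,b_2|b_1C\rangle}+u_{\langle a,b_3|b_2C\rangle}+u_{\langle a,b_1|b_3C\rangle}$$ for some distinct $a,b_1,b_2,b_3\in N$ and some $C\subseteq N\setminus\{a,b_1,b_2,b_3\}$. 2. The relation $(\ast)$ contains a positive multiple of a relation of the form $$u_{\langle a,b_1|C\rangle}+u_{\langle a,b_2|b_1C\rangle}=u_{\langle a,b_2|C\rangle}+u_{\langle a,b_1|b_2C\rangle}$$ with distinct $a,b_1,b_2\in N$ and $C\subseteq N\setminus\{a,b_1,b_2\}$.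
   Context: Unions of sets are written by juxtaposition and singletons $\{i\}$ as $i$. Functions on the power set $\mathcal{P}(N)$ are identified with vectors in $\mathbb{R}^{2^{|N|}}$; $\delta_A(S)=1$ if $S=A$ and $0$ otherwise. For distinct $a,b\in N$ and $C\subseteq N\setminus\{a,b\}$ the elementary imset over $N$ is $u_{\langle a,b|C\rangle}=\delta_{abC}+\delta_C-\delta_{aC}-\delta_{bC}$ (so $u_{\langle a,b|C\rangle}=u_{\langle b,a|C\rangle}$). A relation is an equality $\sum_{i=1}^k\alpha_iu_i=\sum_{j=1}^m\beta_jv_j$ with positive coefficients and distinct elementary imsets $u_1,\dots,u_k,v_1,\dots,v_m$. Such a relation is said to contain another relation $\sum_{i'=1}^{k'}\alpha'_{i'}u'_{i'}=\sum_{j'=1}^{m'}\beta'_{j'}v'_{j'}$ if every $u'_{i'}$ appears on its left-hand side (i.e. is one of the $u_i$) or every $v'_{j'}$ appears on its right-hand side (i.e. is one of the $v_j$). *)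

(* Defs.v *)
From HB Require Import structures.
From mathcomp Require Import all_boot all_order all_algebra.
From mathcomp Require Import reals.

Set Implicit Arguments.
Unset Strict Implicit.
Unset Printing Implicit Defensive.

Import Order.TTheory GRing.Theory Num.Theory.
Local Open Scope ring_scope.

Section Imsets.

Variables (R : realType) (N : finType).

Definition delta (A : {set N}) : {ffun {set N} -> R^o} :=
  [ffun S => (S == A)%:R].

(* The formula for u_<a,b|C>; it is an elementary imset only under the side
   conditions recorded in [elementary]. *)
Definition elem_imset (a b : N) (C : {set N}) : {ffun {set N} -> R^o} :=
  delta (a |: (b |: C)) + delta C - delta (a |: C) - delta (b |: C).

Definition elementary (u : {ffun {set N} -> R^o}) : Prop :=
  exists (a b : N) (C : {set N}),
    [/\ a != b, C \subset ~: [set a; b] & u = elem_imset a b C].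

(* One side of a formal relation: its list of (coefficient, imset) terms.
   Keeping the terms, and not only their sum, lets us speak of the imsets
   appearing on a side. *)
Definition side : Type := seq (R * {ffun {set N} -> R^o}).

Record formal_relation := FormalRelation { lhs : side; rhs : side }.

Definition imsets (s : side) : seq {ffun {set N} -> R^o} := [seq t.2 | t <- s].

Definition side_sum (s : side) : {ffun {set N} -> R^o} :=
  \sum_(t <- s) t.1 *: t.2.

Definition is_relation (r : formal_relation) : Prop :=
  [/\ forall t, t \in lhs r ++ rhs r -> 0 < t.1,
      forall t, t \in lhs r ++ rhs r -> elementary t.2,
      uniq (imsets (lhs r) ++ imsets (rhs r)) &
      side_sum (lhs r) = side_sum (rhs r)].

Definition contains (r r' : formal_relation) : Prop :=
  {subset imsets (lhs r') <= imsets (lhs r)} \/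
  {subset imsets (rhs r') <= imsets (rhs r)}.

Definition scale_side (c : R) (s : side) : side :=
  [seq (c * t.1, t.2) | t <- s].

Definition scale_relation (c : R) (r : formal_relation) : formal_relation :=
  FormalRelation (scale_side c (lhs r)) (scale_side c (rhs r)).

Definition eq_up_to_order (r r' : formal_relation) : Prop :=
  perm_eq (lhs r) (lhs r') /\ perm_eq (rhs r) (rhs r').

Definition cyclic_relation (a b1 b2 b3 : N) (C : {set N}) : formal_relation :=
  FormalRelation
    [:: (1, elem_imset a b1 (b2 |: C)); (1, elem_imset a b2 (b3 |: C));
        (1, elem_imset a b3 (b1 |: C))]
    [:: (1, elem_imset a b2 (b1 |: C)); (1, elem_imset a b3 (b2 |: C));
        (1, elem_imset a b1 (b3 |: C))].

Definition exchange_relation (a b1 b2 : N) (C : {set N}) : formal_relation :=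
  FormalRelation
    [:: (1, elem_imset a b1 C); (1, elem_imset a b2 (b1 |: C))]
    [:: (1, elem_imset a b2 C); (1, elem_imset a b1 (b2 |: C))].

End Imsets.

(* Main.v *)
(* The imset with edge e = {a, b} and bottom C takes the value chi_e(S) at the
   sets S with S \ e = C and 0 elsewhere, where chi_e is the product over x in e
   of the sign of the membership of x.  Let F_e(S) be the weight of the pair
   (e, S \ e) on the left of the relation minus its weight on the right.  The
   relation says that the sum over e of chi_e(S) F_e(S) vanishes for every S, and
   F_e does not depend on the coordinates in e.

   Averaging over coordinates outside e kills the edges that meet them.  This
   shows that every edge occurs on the left, and that an edge with a single left
   term shares exactly one vertex with another edge.  Two left terms with a common
   edge are excluded by evaluating the identity at one set.  If the three edges
   are distinct they form a path, a triangle or a star.  For a path or a triangle,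
   the identity at one well-chosen set yields an exchange pair u_<a,b|C>,
   u_<a,b'|bC> on the left.  For a star with centre a, the identity lives on the
   3-cube of the other end points, where without such a pair its only solution is
   the cyclic relation. *)
Require Import Defs.
From mathcomp Require Import all_boot all_order all_algebra.
From mathcomp Require Import reals boolp zify lra.

Set Implicit Arguments.
Unset Strict Implicit.
Unset Printing Implicit Defensive.

Import Order.TTheory GRing.Theory Num.Theory.
Local Open Scope ring_scope.

(** * Signs, changes of coordinates, and the linear equations on the 3-cube *)

Section Balance.

Variables (R : realFieldType) (N : finType).

Definition sgn (b : bool) : R := if b then 1 else -1.

Lemma sgnN b : sgn (~~ b) = - sgn b.
Proof. by case: b; rewrite /= ?opprK. Qed.

Lemma sgn_neq0 b : sgn b != 0.
Proof. by case: b; rewrite /= ?oppr_eq0 oner_eq0. Qed.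

Definition chi (e S : {set N}) : R := \prod_(x in e) sgn (x \in S).

Lemma chi2 (a b : N) (S : {set N}) :
  a != b -> chi [set a; b] S = sgn (a \in S) * sgn (b \in S).
Proof. by move=> ab; rewrite /chi big_setU1 ?inE //= big_set1. Qed.

Lemma chi_neq0 (e S : {set N}) : chi e S != 0.
Proof. by apply/prodf_neq0 => x _; apply: sgn_neq0. Qed.

(** Symmetric difference, seen as toggling in [S] the coordinates in [A]; letting [A] run through
    the subsets of [K] averages over the coordinates in [K]. *)
Definition symd (S A : {set N}) : {set N} := [set x | (x \in S) (+) (x \in A)].

Definition put (x : N) (b : bool) (S : {set N}) : {set N} :=
  if b then x |: S else S :\ x.

Lemma in_put (x y : N) (b : bool) (S : {set N}) :
  (y \in put x b S) = if y == x then b else y \in S.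
Proof. by rewrite /put; case: b; rewrite !inE; case: eqP. Qed.

Lemma putC (x y : N) (b c : bool) (S : {set N}) :
  x != y -> put x b (put y c S) = put y c (put x b S).
Proof.
move=> xy; apply/setP => t; rewrite !in_put.
by case: (eqVneq t x) => // ->; rewrite (negPf xy).
Qed.

Lemma symd0 (S : {set N}) : symd S set0 = S.
Proof. by apply/setP => x; rewrite !inE addbF. Qed.

Lemma symdA (S A B : {set N}) : symd (symd S A) B = symd S (symd A B).
Proof. by apply/setP => x; rewrite !inE addbA. Qed.

Lemma symdKr (B : {set N}) : involutive (symd^~ B).
Proof. by move=> S; apply/setP => x; rewrite !inE addbK. Qed.

Lemma chi_symd_disjoint (e S A : {set N}) :
  [disjoint e & A] -> chi e (symd S A) = chi e S.
Proof.
move=> dis; apply: eq_bigr => x xe.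
by rewrite inE (disjointFr dis xe) addbF.
Qed.

Lemma chi_symd1 (e S : {set N}) (x : N) :
  x \in e -> chi e (symd S [set x]) = - chi e S.
Proof.
move=> xe; rewrite /chi (bigD1 x) //= [in RHS](bigD1 x) //= !inE eqxx addbT.
rewrite sgnN mulNr; congr (- (_ * _)).
by apply: eq_bigr => y /andP[_ yx]; rewrite !inE (negPf yx) addbF.
Qed.

Lemma adjacent_pairs (e f : {set N}) :
    #|e| = 2%N -> #|f| = 2%N -> #|f :\: e| = 1%N ->
  exists p q y, [/\ uniq [:: p; q; y], e = [set p; q] & f = [set p; y]].
Proof.
move=> e2 f2 /eqP fe1; have /cards1P[p ef] : #|f :&: e| == 1%N.
  by have := cardsID e f; rewrite (eqP fe1) f2 addn1 => -[->].
have /cards1P[q efq] : #|e :\: f| == 1%N.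
  by have := cardsID f e; rewrite setIC ef cards1 e2 add1n => -[->].
have /cards1P[y fey] := fe1.
have De : e = [set p; q] by rewrite -(setID e f) setIC ef efq.
have Df : f = [set p; y] by rewrite -(setID f e) ef fey.
exists p, q, y; split=> //.
have /setIP[pf pe] : p \in f :&: e by rewrite ef set11.
have /setDP[qe qf] : q \in e :\: f by rewrite efq set11.
have /setDP[yf ye] : y \in f :\: e by rewrite fey set11.
rewrite /= !inE negb_or andbT; apply/andP; split; first apply/andP; first split.
- by apply: contraNneq qf => <-.
- by apply: contraNneq ye => <-.
- by apply: contraNneq qf => ->.
Qed.

Lemma set2_neq (e : {set N}) (b c d : N) :
  b \in e -> b \notin [set c; d] -> e != [set c; d].
Proof. by move=> be; apply: contraNneq => <-. Qed.

(* [f1 s2 s3], [f2 s1 s3], [f3 s1 s2] stand for the values of [F] on the edges of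
   a star at the vertex of the 3-cube with coordinates [s1], [s2], [s3]; the two
   implications exclude exchange pairs. *)
Lemma star_cube_neq (f1 f2 f3 : bool -> bool -> R) (x y : bool) :
    (forall s1 s2 s3,
       sgn s1 * f1 s2 s3 + sgn s2 * f2 s1 s3 + sgn s3 * f3 s1 s2 = 0) ->
    0 < f1 x y ->
    (forall s t, 0 < f1 s t -> 0 < f2 (~~ s) t -> False) ->
    (forall s t, 0 < f1 s t -> 0 < f3 (~~ t) s -> False) ->
  y = ~~ x.
Proof.
move=> E f1_gt0 n12 n13.
have le2 : f2 (~~ x) y <= 0 by rewrite leNgt; apply/negP => /(n12 _ _ f1_gt0).
have le3 : f3 (~~ y) x <= 0 by rewrite leNgt; apply/negP => /(n13 _ _ f1_gt0).
(* If [y = x], the equation at this vertex reads [f1 x y = f2 (~~ x) y + f3 (~~ y) x], a positive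
   number equal to a sum of two nonpositive ones. *)
have := E (~~ x) x y; case: x y f1_gt0 le2 le3 {n12 n13} => [] [] //=; lra.
Qed.

(** At the all-true and the all-false vertex the three values occur with the same sign. The excluded
    pairs make all six of them nonpositive, so they vanish, and the other six equations express
    everything through [f1 true false]. *)
Lemma star_cube (f1 f2 f3 : bool -> bool -> R) :
    (forall s1 s2 s3,
       sgn s1 * f1 s2 s3 + sgn s2 * f2 s1 s3 + sgn s3 * f3 s1 s2 = 0) ->
    0 < f1 true false ->
    (forall s t, 0 < f1 s t -> (s, t) = (true, false)) ->
    (forall s t, 0 < f1 s t -> 0 < f2 (~~ s) t -> False) ->
    (forall s t, 0 < f1 s t -> 0 < f3 (~~ t) s -> False) ->
    (forall s t, 0 < f2 s t -> 0 < f3 s (~~ t) -> False) ->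
  forall s t,
    [/\ f1 s t = f1 true false * ((s && ~~ t)%:R - (~~ s && t)%:R),
        f2 s t = f1 true false * ((~~ s && t)%:R - (s && ~~ t)%:R) &
        f3 s t = f1 true false * ((s && ~~ t)%:R - (~~ s && t)%:R)].
Proof.
move=> E a_gt0 u1 n12 n13 n23.
have le0 (z : R) : (0 < z -> False) -> z <= 0 by move=> z_ngt0; rewrite leNgt; apply/negP.
have a_tt : f1 true true <= 0 by apply: le0 => /u1.
have a_ft : f1 false true <= 0 by apply: le0 => /u1.
have a_ff : f1 false false <= 0 by apply: le0 => /u1.
have b_ff : f2 false false <= 0 by apply: le0; apply: n12 a_gt0.
have c_tt : f3 true true <= 0 by apply: le0; apply: n13 a_gt0.
have := (E true true true, E true true false, E true false true,
         E true false false, E false true true, E false true false,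
         E false false true, E false false false).
rewrite /sgn => -[[[[[[[e1 e2] e3] e4] e5] e6] e7] e8].
have b_tf : f2 true false <= - f1 true false by lra.
have c_ft : f3 false true <= - f1 true false by lra.
have b_tt : f2 true true <= 0.
  apply: (le0 _) => b_gt0.
  have := le0 _ (n23 _ _ b_gt0); rewrite /= => c_tf; lra.
have c_ff : f3 false false <= 0.
  apply: (le0 _) => c_gt0.
  have := le0 _ (fun h => n23 false true h c_gt0); rewrite /= => b_ft; lra.
have b_ft : 0 < f2 false true by lra.
have c_tf : 0 < f3 true false by lra.
case; case; split=> /=; lra.
Qed.

(** Summing the eight equations with weights [sgn s1] cancels [f2] and [f3] and leaves twice the sum
    of the values of [f1], so these vanish; the other two functions are symmetric. *)
Lemma star_cube_le0 (f1 f2 f3 : bool -> bool -> R) :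
    (forall s1 s2 s3,
       sgn s1 * f1 s2 s3 + sgn s2 * f2 s1 s3 + sgn s3 * f3 s1 s2 = 0) ->
    (forall s t, f1 s t <= 0) -> (forall s t, f2 s t <= 0) ->
    (forall s t, f3 s t <= 0) ->
  forall s t, [/\ f1 s t = 0, f2 s t = 0 & f3 s t = 0].
Proof.
move=> E le1 le2 le3.
have := (E true true true, E true true false, E true false true,
         E true false false, E false true true, E false true false,
         E false false true, E false false false).
have := (le1 true true, le1 true false, le1 false true, le1 false false,
         le2 true true, le2 true false, le2 false true, le2 false false,
         le3 true true, le3 true false, le3 false true, le3 false false).
rewrite /sgn => -[[[[[[[[[[[? ?] ?] ?] ?] ?] ?] ?] ?] ?] ?] ?].
move=> [[[[[[[? ?] ?] ?] ?] ?] ?] ?] s t.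
by case: s; case: t; split; lra.
Qed.

(* [F e S] is the signed weight of the imset with edge [e] and bottom
   [S :\: e]. *)
Variable F : {set N} -> {set N} -> R.
Hypothesis F_base : forall e S, F e (S :\: e) = F e S.
Hypothesis F_balance : forall S,
  \sum_(e : {set N} | #|e| == 2) chi e S * F e S = 0.

(** * Averaging the balance over coordinates outside an edge *)

Lemma F_ext (e S T : {set N}) :
  (forall x, x \notin e -> (x \in S) = (x \in T)) -> F e S = F e T.
Proof.
move=> ST; rewrite -F_base -[RHS]F_base; congr F; apply/setP => x.
by rewrite !inE; case: (boolP (x \in e)) => // /ST.
Qed.

(* For an edge meeting [K] in [x], toggling [x] pairs opposite terms. *)
Lemma sum_symd_meeting (e K S : {set N}) : ~~ [disjoint e & K] ->
  \sum_(A : {set N} | A \subset K) chi e (symd S A) * F e (symd S A) = 0.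
Proof.
move=> /pred0Pn[x /andP[/= xe xK]].
set T := LHS; suff : T = - T by move=> ?; lra.
rewrite {1}/T (reindex_inj (inv_inj (symdKr [set x]))) /= /T -sumrN.
apply: eq_big => [A|A _].
  apply/subsetP/subsetP => AK y.
    by move=> yA; case: (eqVneq y x) => [->//|yx]; apply: AK; rewrite !inE yA (negPf yx).
  by rewrite !inE; case: (eqVneq y x) => [->//|yx]; rewrite addbF; apply: AK.
rewrite -symdA chi_symd1 // mulNr; congr (- (_ * _)); apply: F_ext => y ye.
by rewrite !inE; case: (eqVneq y x) ye => [->|_]; rewrite ?xe // addbF.
Qed.

(** Summing the balance over all [symd S A] with [A] inside [K] cancels every edge meeting [K]. The
    edges other than [e] that miss [K] are inactive, so only [e] remains, with the constant sign
    [chi e S]. *)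
Lemma sum_symd_edge (e K S : {set N}) : #|e| = 2%N -> K \subset ~: e ->
    (forall e' : {set N}, #|e'| = 2%N -> e' != e -> [disjoint e' & K] ->
       forall T, F e' T = 0) ->
  \sum_(A : {set N} | A \subset K) F e (symd S A) = 0.
Proof.
move=> e2 Ke others.
have dis (A : {set N}) : A \subset K -> [disjoint e & A].
  by move=> AK; rewrite disjoint_sym disjoints_subset (subset_trans AK).
apply: (mulfI (chi_neq0 e S)); rewrite mulr0.
have: \sum_(A : {set N} | A \subset K)
    \sum_(e' : {set N} | #|e'| == 2) chi e' (symd S A) * F e' (symd S A) = 0.
  by apply: big1 => A _; apply: F_balance.
rewrite exchange_big /= (bigD1 e) ?e2 //= [X in _ + X]big1 ?addr0 => [sum0|].
  by rewrite mulr_sumr -[RHS]sum0; apply: eq_bigr => A AK; rewrite chi_symd_disjoint ?dis.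
move=> e' /andP[/eqP e'2 e'e].
have [dK|] := boolP [disjoint e' & K]; last exact: sum_symd_meeting.
by apply: big1 => A _; rewrite others ?mulr0.
Qed.

Lemma edge_meets_setC (e e' : {set N}) :
  #|e| = 2%N -> #|e'| = 2%N -> e' != e -> ~~ [disjoint e' & ~: e].
Proof.
move=> e2 e'2; apply: contra; rewrite disjoints_subset setCK => e'e.
by rewrite eqEcard e'e e2 e'2.
Qed.

Lemma sum_symd_setC (e S : {set N}) : #|e| = 2%N ->
  \sum_(A : {set N} | A \subset ~: e) F e (symd S A) = 0.
Proof.
move=> e2; apply: sum_symd_edge => // e' e'2 e'e.
by rewrite (negPf (edge_meets_setC e2 e'2 e'e)).
Qed.

(** The values of [F e] sum to zero over the toggles outside [e]. Hence an edge that occurs in the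
    relation at all occurs on the left. *)
Lemma F_le0_eq0 (e : {set N}) : #|e| = 2%N ->
  (forall S, F e S <= 0) -> forall S, F e S = 0.
Proof.
move=> e2 Fle S.
have /eqP := sum_symd_setC S e2; rewrite -oppr_eq0 -sumrN psumr_eq0 => [|A _].
  by move=> /allP/(_ set0); rewrite mem_index_enum sub0set symd0 oppr_eq0 => /(_ isT)/eqP.
by rewrite oppr_ge0.
Qed.

(** Averaging over everything outside [e] yields a negative value of [F e], at a set differing from
    [C] in some [z] outside [e]. If all edges sharing exactly one vertex with [e] were inactive,
    averaging over the complement of [z |: e] would isolate [e] again and turn this negative value
    into a positive one with the same status of [z], against the uniqueness of the positive
    bottom. *)
Lemma adjacent_edge (e C : {set N}) : #|e| = 2%N -> 0 < F e C ->
    (forall S, 0 < F e S -> S :\: e = C :\: e) ->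
  exists e' S : {set N}, [/\ #|e'| = 2%N, #|e' :\: e| = 1%N & F e' S != 0].
Proof.
move=> e2 FC FC_only.
have [/existsP[e' /existsP[S /and3P[/eqP ? /eqP ? ?]]]|none] := boolP
  [exists e' : {set N}, [exists S : {set N},
    [&& #|e'| == 2, #|e' :\: e| == 1 & F e' S != 0]]].
  by exists e', S.
have inactive (e' : {set N}) : #|e'| = 2%N -> #|e' :\: e| = 1%N -> forall T, F e' T = 0.
  move=> e'2 e'1 T; apply/eqP; apply: contraR none => nz.
  by apply/existsP; exists e'; apply/existsP; exists T; rewrite e'2 e'1 nz.
have [A Ae FA] : exists2 A : {set N}, A \subset ~: e & F e (symd C A) < 0.
  apply/exists_inP; apply: contraT; rewrite negb_exists_in => /forall_inP Fge.
  have := sum_symd_setC C e2; rewrite (bigD1 set0) ?sub0set //= symd0.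
  set s := \sum_(_ | _) _ => sum0.
  have : 0 <= s by apply: sumr_ge0 => A /andP[/Fge]; rewrite -leNgt.
  move=> s_ge0; have : F e C <= 0 by lra.
  by rewrite leNgt FC.
have [z zA] : exists z, z \in A.
  apply/set0Pn; apply: contraTneq FA => ->; rewrite symd0 -leNgt; exact: ltW.
have ze : z \notin e by have := subsetP Ae z zA; rewrite inE.
pose K := ~: (z |: e).
have KA : K \subset ~: e by rewrite setCS subsetUr.
have sum0 : \sum_(B : {set N} | B \subset K) F e (symd (symd C A) B) = 0.
  apply: sum_symd_edge => // e' e'2 e'e dK; apply: inactive => //.
  have sub : e' :\: e \subset [set z].
    apply/subsetP => x /setDP[xe' xe].
    by have := disjointFr dK xe'; rewrite !inE (negPf xe) orbF => /negbFE.
  have ne : e' :\: e != set0.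
    by rewrite setD_eq0; apply: contra e'e => e'sub; rewrite eqEcard e'sub e2 e'2.
  apply/eqP; rewrite eqn_leq card_gt0 ne andbT.
  by rewrite (leq_trans (subset_leq_card sub)) ?cards1.
have [B BK FB] : exists2 B : {set N}, B \subset K & 0 < F e (symd (symd C A) B).
  apply/exists_inP; apply: contraT; rewrite negb_exists_in => /forall_inP Fle.
  move: sum0; rewrite (bigD1 set0) ?sub0set //= symd0.
  set s := \sum_(_ | _) _ => sum0.
  have : s <= 0 by apply: sumr_le0 => B' /andP[/Fle]; rewrite -leNgt.
  move=> s_le0; have : 0 <= F e (symd C A) by lra.
  by rewrite leNgt FA.
have /setP/(_ z) := FC_only _ FB; rewrite !inE ze zA /=.
have zB : z \in B = false.
  by apply/negP => /(subsetP BK); rewrite !inE eqxx.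
by rewrite zB addbF addbT; case: (z \in C).
Qed.

Lemma F_put (e : {set N}) (x : N) (b : bool) (S : {set N}) :
  x \in e -> F e (put x b S) = F e S.
Proof.
by move=> xe; apply: F_ext => t; rewrite in_put; case: (eqVneq t x) => // ->; rewrite xe.
Qed.

(** * Exchange pairs, paths of edges and the cyclic pattern *)

(** The left side of an exchange relation, found among the terms of positive signed weight. *)
Definition edge_chain : Prop := exists (a b b' : N) (C : {set N}),
  [/\ uniq [:: a; b; b'], C \subset ~: [set a; b; b'],
      0 < F [set a; b] C & 0 < F [set a; b'] (b |: C)].

(** In an exchange pair, one bottom contains [y] exactly when the other omits [q]. Whether [y] lies
    in [S] only decides which of the two terms comes first. *)
Lemma edge_chain_put (p q y : N) (S : {set N}) : uniq [:: p; q; y] ->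
  0 < F [set p; q] S -> 0 < F [set p; y] (put q (~~ (y \in S)) S) ->
  edge_chain.
Proof.
move=> pqy; have := pqy; rewrite /= !inE negb_or !andbT => /andP[/andP[pq py] qy].
pose C := S :\: [set p; q; y].
have CD : C \subset ~: [set p; q; y] by rewrite /C subsetDr.
have pyq : uniq [:: p; y; q] by rewrite /= !inE negb_or pq py eq_sym qy.
have CD' : C \subset ~: [set p; y; q] by rewrite setUAC.
case yS : (y \in S) => /= Fpq Fpy.
  exists p, y, q, C; split=> //.
    rewrite (F_ext (T := put q false S)) // => t; rewrite !(inE, in_put) !negb_or.
    by case: (eqVneq t q) => //= _ /andP[-> ->].
  rewrite (F_ext (T := S)) // => t; rewrite !inE !negb_or => /andP[-> ->].
  by case: (eqVneq t y) => // ->; rewrite yS.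
exists p, q, y, C; split=> //.
  rewrite (F_ext (T := S)) // => t; rewrite !inE !negb_or => /andP[-> ->].
  by case: (eqVneq t y) => // ->; rewrite yS.
rewrite (F_ext (T := put q true S)) // => t; rewrite !(inE, in_put) !negb_or.
by case: (eqVneq t q) => //= _ /andP[-> ->].
Qed.

Lemma balance_seq (es : seq {set N}) (S : {set N}) :
    uniq es -> (forall e, e \in es -> #|e| = 2%N) ->
    (forall e : {set N}, #|e| = 2%N -> e \notin es -> forall T, F e T = 0) ->
  \sum_(e <- es) chi e S * F e S = 0.
Proof.
move=> es_uniq es2 others; rewrite big_uniq //= -[RHS](F_balance S).
rewrite big_mkcond [RHS]big_mkcond; apply: eq_bigr => e _.
case: ifP => [/es2->//|/negbT e_es]; case: ifP => // /eqP e2.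
by rewrite others ?mulr0.
Qed.

(* With [q] and [p] set opposite to [y] and [z], the balance at [S] reads
   [F [set p; q] = F [set p; y] + F [set q; z]]. *)
Lemma path_edge_chain (p q y z : N) (S : {set N}) :
    uniq [:: p; q; y] -> uniq [:: p; q; z] -> 0 < F [set p; q] S ->
    (forall e : {set N}, #|e| = 2%N ->
       e \notin [:: [set p; q]; [set p; y]; [set q; z]] ->
       forall T, F e T = 0) ->
  edge_chain.
Proof.
move=> pqy pqz FS others; have := pqy; have := pqz.
rewrite /= !inE !negb_or !andbT => /andP[/andP[pq pz] qz] /andP[/andP[_ py] qy].
set T := put p (~~ (z \in S)) (put q (~~ (y \in S)) S).
have [pT qT yT zT] : [/\ p \in T = ~~ (z \in S), q \in T = ~~ (y \in S),
    y \in T = (y \in S) & z \in T = (z \in S)].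
  rewrite !in_put !eqxx (eq_sym q p) !(eq_sym y) !(eq_sym z).
  by rewrite (negPf pq) (negPf py) (negPf pz) (negPf qy) (negPf qz).
have F1 : F [set p; q] T = F [set p; q] S by rewrite /T F_put ?F_put ?inE ?eqxx ?orbT.
have F2 : F [set p; y] T = F [set p; y] (put q (~~ (y \in S)) S).
  by rewrite (@F_put _ p) ?inE ?eqxx.
have F3 : F [set q; z] T = F [set q; z] (put p (~~ (z \in S)) S).
  by rewrite /T putC // F_put ?inE ?eqxx.
have : \sum_(e <- [:: [set p; q]; [set p; y]; [set q; z]]) chi e T * F e T = 0.
  apply: balance_seq => // [|e].
    rewrite /= !inE negb_or andbT (set2_neq (b := q)) ?inE ?eqxx ?orbT //.
      by rewrite !(set2_neq (b := p)) ?inE ?eqxx ?orbT // negb_or pq.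
    by rewrite negb_or (eq_sym q p) pq.
  by rewrite !inE => /or3P[]/eqP->; rewrite cards2 ?pq ?py ?qz.
rewrite !big_cons big_nil addr0 !chi2 // pT qT yT zT F1 F2 F3 => bal.
(* One of the two summands must be positive, and either of them forms an exchange pair with the edge
   [[set p; q]]. *)
have [F2_gt0|F2_le0] := ltP 0 (F [set p; y] (put q (~~ (y \in S)) S)).
  exact: edge_chain_put FS F2_gt0.
apply: (@edge_chain_put q p z S); first by rewrite /= !inE !negb_or (eq_sym q) pq pz qz.
  by rewrite setUC.
move: bal F2_le0 FS; case: (y \in S); case: (z \in S) => /=; lra.
Qed.

(** The left terms of [cyclic_relation], encoded as pairs of an edge and a bottom. *)
Definition cyclic_lhs (a b1 b2 b3 : N) (C : {set N}) :=
  [:: ([set a; b1], b2 |: C); ([set a; b2], b3 |: C); ([set a; b3], b1 |: C)].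

Definition cyclic_rhs (a b1 b2 b3 : N) (C : {set N}) :=
  [:: ([set a; b2], b1 |: C); ([set a; b3], b2 |: C); ([set a; b1], b3 |: C)].

Definition edge_cycle : Prop := exists (a b1 b2 b3 : N) (C : {set N}) (c : R),
  [/\ uniq [:: a; b1; b2; b3], C \subset ~: [set a; b1; b2; b3] & 0 < c] /\
  [/\ forall t, t \in cyclic_lhs a b1 b2 b3 C -> F t.1 t.2 = c,
      forall t, t \in cyclic_rhs a b1 b2 b3 C -> F t.1 t.2 = - c &
      forall e S : {set N}, #|e| = 2%N -> F e S != 0 ->
        (e, S :\: e) \in cyclic_lhs a b1 b2 b3 C ++ cyclic_rhs a b1 b2 b3 C].

(** * Stars: three edges with a common vertex *)

Section Star.

Variables (p b1 b2 b3 : N).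
Hypothesis p_b_uniq : uniq [:: p; b1; b2; b3].
Hypothesis F_inactive : forall e : {set N}, #|e| = 2%N ->
  e \notin [:: [set p; b1]; [set p; b2]; [set p; b3]] -> forall T, F e T = 0.
Hypothesis F_pos_uniq : forall e S T : {set N},
  e \in [:: [set p; b1]; [set p; b2]; [set p; b3]] ->
  0 < F e S -> 0 < F e T -> S :\: e = T :\: e.
Hypothesis no_chain : ~ edge_chain.

Lemma star_neq : [/\ p != b1, p != b2 & p != b3] /\ [/\ b1 != b2, b1 != b3 & b2 != b3].
Proof.
move: p_b_uniq; rewrite /= !inE !negb_or !andbT.
by case/and3P=> /and3P[-> -> ->] /andP[-> ->] ->.
Qed.

(** The restriction of [F] to the 3-cube through [T] in the directions of the three leaves. Only two
    coordinates are arguments, since the value does not depend on the leaf of the edge itself. *)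
Definition star1 (T : {set N}) s2 s3 := F [set p; b1] (put b2 s2 (put b3 s3 T)).
Definition star2 (T : {set N}) s1 s3 := F [set p; b2] (put b1 s1 (put b3 s3 T)).
Definition star3 (T : {set N}) s1 s2 := F [set p; b3] (put b1 s1 (put b2 s2 T)).

Lemma star_balance T s1 s2 s3 :
  sgn s1 * star1 T s2 s3 + sgn s2 * star2 T s1 s3 + sgn s3 * star3 T s1 s2 = 0.
Proof.
have [[pb1 pb2 pb3] [b12 b13 b23]] := star_neq.
(* With the centre [p] in [S], each [chi] reduces to the sign of the leaf. *)
set S := put p true (put b1 s1 (put b2 s2 (put b3 s3 T))).
have [pS b1S b2S b3S] :
    [/\ p \in S, (b1 \in S) = s1, (b2 \in S) = s2 & (b3 \in S) = s3].
  rewrite !in_put !eqxx ![_ == p]eq_sym (negPf pb1) (negPf pb2) (negPf pb3).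
  by rewrite ![_ == b1]eq_sym (negPf b12) (negPf b13) [_ == b2]eq_sym (negPf b23).
have ne x y : p != x -> x != y -> [set p; x] != [set p; y].
  move=> px xy; rewrite (@set2_neq _ x) // !inE ?eqxx ?orbT //.
  by rewrite negb_or (eq_sym x p) px.
have : \sum_(e <- [:: [set p; b1]; [set p; b2]; [set p; b3]]) chi e S * F e S = 0.
  apply: balance_seq => // [|e].
    by rewrite /= !inE negb_or andbT !ne.
  by rewrite !inE => /or3P[]/eqP->; rewrite cards2 ?pb1 ?pb2 ?pb3.
have FS x (T' : {set N}) : (forall t, t != p -> t != x -> (t \in S) = (t \in T')) ->
    F [set p; x] S = F [set p; x] T'.
  by move=> H; apply: F_ext => t; rewrite in_set2 negb_or => /andP[]; apply: H.
rewrite !big_cons big_nil addr0 !chi2 // pS b1S b2S b3S /star1 /star2 /star3.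
rewrite (FS b1 (put b2 s2 (put b3 s3 T))) ?(FS b2 (put b1 s1 (put b3 s3 T)))
  ?(FS b3 (put b1 s1 (put b2 s2 T))).
- by rewrite /= !mul1r addrA.
all: by move=> t /negPf tp /negPf tb; rewrite !in_put tp tb.
Qed.

Lemma starE (S T : {set N}) :
    (forall t, t \notin [set p; b1; b2; b3] -> (t \in S) = (t \in T)) ->
  [/\ F [set p; b1] S = star1 T (b2 \in S) (b3 \in S),
      F [set p; b2] S = star2 T (b1 \in S) (b3 \in S) &
      F [set p; b3] S = star3 T (b1 \in S) (b2 \in S)].
Proof.
move=> ST.
have put2 x y z : [set p; x; y; z] = [set p; b1; b2; b3] ->
    F [set p; x] S = F [set p; x] (put y (y \in S) (put z (z \in S) T)).
  move=> V; apply: F_ext => t; rewrite in_set2 negb_or => /andP[tp tx].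
  rewrite !in_put; have [->//|ty] := eqVneq t y; have [->//|tz] := eqVneq t z.
  by apply: ST; rewrite -V !inE !negb_or tp tx ty tz.
split; apply: put2 => //; apply/setP => t; rewrite !inE -!orbA //.
all: by case: (t == p); case: (t == b1); case: (t == b2); case: (t == b3).
Qed.

Lemma star_no12 T s t : 0 < star1 T s t -> 0 < star2 T (~~ s) t -> False.
Proof.
have [[pb1 pb2 pb3] [b12 b13 b23]] := star_neq.
move=> F1 F2; apply: no_chain.
apply: (@edge_chain_put p b1 b2 (put b2 s (put b3 t T))) => //.
  by rewrite /= !inE negb_or pb1 pb2 b12.
by rewrite in_put eqxx putC // F_put ?inE ?eqxx ?orbT.
Qed.

Lemma star_no13 T s t : 0 < star1 T s t -> 0 < star3 T (~~ t) s -> False.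
Proof.
have [[pb1 pb2 pb3] [b12 b13 b23]] := star_neq.
rewrite /star1 putC // => F1 F3; apply: no_chain.
apply: (@edge_chain_put p b1 b3 (put b3 t (put b2 s T))) => //.
  by rewrite /= !inE negb_or pb1 pb3 b13.
by rewrite in_put eqxx putC // F_put ?inE ?eqxx ?orbT.
Qed.

Lemma star_no23 T s t : 0 < star2 T s t -> 0 < star3 T s (~~ t) -> False.
Proof.
have [[pb1 pb2 pb3] [b12 b13 b23]] := star_neq.
rewrite /star2 /star3 (putC s t T b13) (putC s (~~ t) T b12) => F2 F3; apply: no_chain.
apply: (@edge_chain_put p b2 b3 (put b3 t (put b1 s T))) => //.
  by rewrite /= !inE negb_or pb2 pb3 b23.
by rewrite in_put eqxx putC // F_put ?inE ?eqxx ?orbT.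
Qed.

(** Each edge has at most one positive bottom, and all three are attained on the cube of [S0]. A
    cube differing from it at a coordinate off the star has no positive value left, so
    [star_cube_le0] applies. *)
Lemma star_cube0 (S0 T : {set N}) : 
    (forall x, x \in [:: b1; b2; b3] -> exists S : {set N}, 0 < F [set p; x] S /\
       forall t, t \notin [set p; b1; b2; b3] -> (t \in S) = (t \in S0)) ->
    (exists t, t \notin [set p; b1; b2; b3] /\ (t \in T) != (t \in S0)) ->
  forall s t, [/\ star1 T s t = 0, star2 T s t = 0 & star3 T s t = 0].
Proof.
move=> S0P [y [yV yT]].
have le0 x (U : {set N}) : x \in [:: b1; b2; b3] -> (y \in U) = (y \in T) ->
    F [set p; x] U <= 0.
  move=> xb yU; rewrite leNgt; apply/negP => FU.
  have [S [FS /(_ y yV) yS]] := S0P x xb.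
  have yx : y \notin [set p; x].
    move: yV xb; rewrite !inE !negb_or => /andP[/andP[/andP[-> y1] y2] y3].
    by case/or3P => /eqP->.
  have /setP/(_ y) : U :\: [set p; x] = S :\: [set p; x].
    apply: F_pos_uniq FU FS; move: xb; rewrite !inE.
    by case/or3P => /eqP->; rewrite eqxx ?orbT.
  rewrite 2!in_setD yx yU yS /=; exact/eqP.
move: yV; rewrite !inE !negb_or => /andP[/andP[/andP[_ /negPf y1] /negPf y2] /negPf y3].
by apply: star_cube_le0 (star_balance T) _ _ _ => s t; apply: le0;
  rewrite ?in_put ?y1 ?y2 ?y3 ?inE ?eqxx ?orbT.
Qed.

(** On the cube of [S0], [star_cube] produces the cyclic pattern, in which every one of the three
    edges has a positive value; [star_cube0] then empties all other cubes. *)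
Lemma star_edge_cycle S0 : 0 < star1 S0 true false -> edge_cycle.
Proof.
move=> a_gt0.
have [[pb1 pb2 pb3] [b12 b13 b23]] := star_neq.
have u1 s t : 0 < star1 S0 s t -> (s, t) = (true, false).
  have e1 : [set p; b1] \in [:: [set p; b1]; [set p; b2]; [set p; b3]] by rewrite mem_head.
  move=> /(F_pos_uniq e1 a_gt0)/setP E.
  have {E} := (E b2, E b3).
  rewrite !in_setD !in_put !inE !eqxx ![_ == p]eq_sym (negPf pb2) (negPf pb3).
  rewrite ![_ == b1]eq_sym (negPf b12) (negPf b13) eq_sym (negPf b23) /=.
  by case=> <- <-.
have val := star_cube (star_balance S0) a_gt0 u1 (star_no12 (T := S0))
  (star_no13 (T := S0)) (star_no23 (T := S0)).
set a := star1 S0 true false in a_gt0 val.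
(* [D], the part of [S0] off the star, is the set [C] of the cyclic relation. *)
pose V := [set p; b1; b2; b3]; pose D := S0 :\: V.
have agree x t : t \notin V -> x \in V -> (t \in x |: D) = (t \in S0).
  by move=> tV xV; rewrite in_setU1 in_setD tV /=; case: eqVneq tV xV => // -> /negPf->.
have inD x : x \in V -> x \in D = false by move=> xV; rewrite in_setD xV.
have [V1 V2 V3] : [/\ b1 \in V, b2 \in V & b3 \in V] by rewrite !inE !eqxx ?orbT.
have lhsP t : t \in cyclic_lhs p b1 b2 b3 D -> F t.1 t.2 = a.
  rewrite !inE => /or3P[]/eqP-> /=.
  - have [-> _ _] := starE (fun t tV => agree b2 t tV V2).
    have [-> _ _] := val (b2 \in b2 |: D) (b3 \in b2 |: D).
    by rewrite !in_setU1 eqxx !inD // eq_sym (negPf b23) subr0 mulr1.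
  - have [_ -> _] := starE (fun t tV => agree b3 t tV V3).
    have [_ -> _] := val (b1 \in b3 |: D) (b3 \in b3 |: D).
    by rewrite !in_setU1 eqxx !inD // (negPf b13) subr0 mulr1.
  - have [_ _ ->] := starE (fun t tV => agree b1 t tV V1).
    have [_ _ ->] := val (b1 \in b1 |: D) (b2 \in b1 |: D).
    by rewrite !in_setU1 eqxx !inD // eq_sym (negPf b12) subr0 mulr1.
have rhsP t : t \in cyclic_rhs p b1 b2 b3 D -> F t.1 t.2 = - a.
  rewrite !inE => /or3P[]/eqP-> /=.
  - have [_ -> _] := starE (fun t tV => agree b1 t tV V1).
    have [_ -> _] := val (b1 \in b1 |: D) (b3 \in b1 |: D).
    by rewrite !in_setU1 eqxx !inD // eq_sym (negPf b13) sub0r mulrN1.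
  - have [_ _ ->] := starE (fun t tV => agree b2 t tV V2).
    have [_ _ ->] := val (b1 \in b2 |: D) (b2 \in b2 |: D).
    by rewrite !in_setU1 eqxx !inD // (negPf b12) sub0r mulrN1.
  - have [-> _ _] := starE (fun t tV => agree b3 t tV V3).
    have [-> _ _] := val (b2 \in b3 |: D) (b3 \in b3 |: D).
    by rewrite !in_setU1 eqxx !inD // (negPf b23) sub0r mulrN1.
exists p, b1, b2, b3, D, a; split; first by split; rewrite ?subsetDr.
split=> // e S e2 FS.
have [e_es|/F_inactive F0] := boolP (e \in [:: [set p; b1]; [set p; b2]; [set p; b3]]);
  last by rewrite F0 ?eqxx in FS.
have [/forall_inP SS0|] := boolP [forall (t | t \notin V), (t \in S) == (t \in S0)].
  have {}SS0 t : t \notin V -> (t \in S) = (t \in S0) by move=> /SS0/eqP.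
  have [E1 E2 E3] := starE SS0.
  have [V23 _ _] := val (b2 \in S) (b3 \in S).
  have [_ V13 _] := val (b1 \in S) (b3 \in S).
  have [_ _ V12] := val (b1 \in S) (b2 \in S).
  (* On this cube a nonzero value means that exactly one of the two other leaves lies in [S]; the
     bottom is then that leaf added to [D]. *)
  have SD x y z : [set p; x; y; z] = V -> p != y -> x != y ->
      y \in S -> (z \in S) = false -> S :\: [set p; x] = y |: D.
    move=> DV yp yx yS zS; apply/setP => t; rewrite in_setD in_set2 in_setU1 in_setD.
    have [->|ty] := eqVneq t y; first by rewrite eq_sym (negPf yp) eq_sym (negPf yx) yS.
    have [tV|tV] := boolP (t \in V).
      move: tV; rewrite -DV !inE (negPf ty) orbF.
      by case: eqP => //= _; case: eqP => //= _ /eqP->.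
    move: (tV); rewrite -{1}DV !inE !negb_or => /andP[/andP[/andP[-> ->] _] _].
    by rewrite /= SS0.
  have [b21 b31 b32] : [/\ b2 != b1, b3 != b1 & b3 != b2] by split; rewrite eq_sym.
  have V132 : [set p; b1; b3; b2] = V by rewrite setUAC.
  have V213 : [set p; b2; b1; b3] = V by rewrite (setUAC [set p]).
  have V321 : [set p; b3; b2; b1] = V by rewrite (setUAC [set p]) setUAC (setUAC [set p]).
  have V231 : [set p; b2; b3; b1] = V by rewrite setUAC (setUAC [set p]).
  have V312 : [set p; b3; b1; b2] = V by rewrite (setUAC [set p]) setUAC.
  move: e_es FS; rewrite !inE => /or3P[]/eqP->.
  - rewrite E1 V23; case b2S: (b2 \in S); case b3S: (b3 \in S);
      rewrite /= ?subrr ?mulr0 ?eqxx // => _.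
      by rewrite (SD b1 b2 b3) // eqxx.
    by rewrite (SD b1 b3 b2) // eqxx ?orbT.
  - rewrite E2 V13; case b1S: (b1 \in S); case b3S: (b3 \in S);
      rewrite /= ?subrr ?mulr0 ?eqxx // => _.
      by rewrite (SD b2 b1 b3) // eqxx ?orbT.
    by rewrite (SD b2 b3 b1) // eqxx ?orbT.
  - rewrite E3 V12; case b1S: (b1 \in S); case b2S: (b2 \in S);
      rewrite /= ?subrr ?mulr0 ?eqxx // => _.
      by rewrite (SD b3 b1 b2) // eqxx ?orbT.
    by rewrite (SD b3 b2 b1) // eqxx ?orbT.
move/forall_inPn => [y yV yS].
have S0P x : x \in [:: b1; b2; b3] -> exists S : {set N}, 0 < F [set p; x] S /\
    forall t, t \notin V -> (t \in S) = (t \in S0).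
  rewrite !inE => /or3P[]/eqP->; [exists (b2 |: D)|exists (b3 |: D)|exists (b1 |: D)];
    (split=> [|t tV]; last exact: agree);
    by rewrite (lhsP (_, _)) ?inE ?eqxx ?orbT.
have z := star_cube0 S0P (ex_intro _ y (conj yV yS)).
have [E1 E2 E3] := starE (fun t _ => erefl (t \in S)).
move: FS; rewrite !inE in e_es; case/or3P: e_es => /eqP->.
- by rewrite E1; have [-> _ _] := z (b2 \in S) (b3 \in S); rewrite eqxx.
- by rewrite E2; have [_ -> _] := z (b1 \in S) (b3 \in S); rewrite eqxx.
- by rewrite E3; have [_ _ ->] := z (b1 \in S) (b2 \in S); rewrite eqxx.
Qed.

End Star.

Definition uniquely_positive (e : {set N}) : Prop :=
  forall S T, 0 < F e S -> 0 < F e T -> S :\: e = T :\: e.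

(** Without an exchange pair, [star_cube_neq] forces exactly one of [b2], [b3] into the bottom of
    the first edge. Exchanging the names of [b2] and [b3] if necessary makes it [b2], as
    [star_edge_cycle] expects. *)
Lemma star_hub (p b1 b2 b3 : N) (C : {set N}) :
    uniq [:: p; b1; b2; b3] ->
    (forall e : {set N}, #|e| = 2%N ->
       e \notin [:: [set p; b1]; [set p; b2]; [set p; b3]] ->
       forall T, F e T = 0) ->
    (forall e, e \in [:: [set p; b1]; [set p; b2]; [set p; b3]] ->
       uniquely_positive e) ->
    0 < F [set p; b1] C ->
  edge_chain \/ edge_cycle.
Proof.
move=> pb inactive pos_uniq FC.
have [|no_chain] := pselect edge_chain; [by left|right].
have put_id : star1 p b1 b2 b3 C (b2 \in C) (b3 \in C) = F [set p; b1] C.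
  apply: F_ext => t _; rewrite !in_put.
  by have [->|_] := eqVneq t b2; [|have [->|_] := eqVneq t b3].
have b3C : (b3 \in C) = ~~ (b2 \in C).
  apply: star_cube_neq (star_balance pb inactive C) _ _ _.
  - by rewrite put_id.
  - exact: star_no12.
  - exact: star_no13.
have pos_uniq3 e S T : e \in [:: [set p; b1]; [set p; b2]; [set p; b3]] ->
  0 < F e S -> 0 < F e T -> S :\: e = T :\: e by move/pos_uniq; apply.
case b2C : (b2 \in C); last first.
  pose es := [:: [set p; b1]; [set p; b3]; [set p; b2]].
  have esE e : e \in es = (e \in [:: [set p; b1]; [set p; b2]; [set p; b3]]).
    by rewrite !inE (orbC (e == [set p; b3])).
  apply: (@star_edge_cycle p b1 b3 b2 _ _ _ no_chain C).
  - move: pb; rewrite /= !inE !negb_or !andbT.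
    by case/and3P=> /and3P[-> -> ->] /andP[-> ->]; rewrite eq_sym => ->.
  - by move=> e e2; rewrite -/es esE; apply: inactive.
  - by move=> e S T; rewrite -/es esE; apply: pos_uniq3.
  - move: FC; rewrite -put_id b3C b2C /star1 putC //.
    by move: pb; rewrite /= !inE !negb_or => /and4P[].
apply: (@star_edge_cycle p b1 b2 b3 pb inactive pos_uniq3 no_chain C).
by move: FC; rewrite -put_id b3C b2C.
Qed.

(** * Two active edges, and three edges with a hub *)

(** Once [y] is set opposite to [q], the two edges carry opposite signs, and the balance makes their
    values equal. *)
Lemma two_edges_pos (p q y : N) (C : {set N}) : uniq [:: p; q; y] ->
    (forall e : {set N}, #|e| = 2%N ->
       e \notin [:: [set p; q]; [set p; y]] -> forall T, F e T = 0) ->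
    0 < F [set p; y] C ->
  0 < F [set p; q] (put y (~~ (q \in C)) C).
Proof.
rewrite /= !inE !negb_or !andbT => /andP[/andP[pq py] qy] inactive FC.
set T := put y _ C.
have [qT yT] : (q \in T) = (q \in C) /\ (y \in T) = ~~ (q \in C).
  by rewrite !in_put (negPf qy) eqxx.
have : \sum_(e <- [:: [set p; q]; [set p; y]]) chi e T * F e T = 0.
  apply: balance_seq => // [|e].
    by rewrite /= inE andbT (@set2_neq _ q) // !inE ?eqxx ?orbT // negb_or eq_sym pq.
  by rewrite !inE => /orP[]/eqP->; rewrite cards2 ?pq ?py.
rewrite !big_cons big_nil addr0 !chi2 // qT yT.
rewrite [F [set p; y] T]F_put ?inE ?eqxx ?orbT //.
by move: FC; case: (p \in T); case: (q \in C); rewrite /sgn /=; lra.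
Qed.

(** [two_edges_pos] sends positive bottoms of [e] to positive bottoms of [f]. This map is injective,
    because the status of [q] can be read off from that of [y]. *)
Lemma two_edges_uniq (e f : {set N}) :
    #|e| = 2%N -> #|f| = 2%N -> #|e :\: f| = 1%N ->
    (forall e' : {set N}, #|e'| = 2%N -> e' \notin [:: f; e] -> forall T, F e' T = 0) ->
  uniquely_positive f -> uniquely_positive e.
Proof.
move=> e2 f2 /(adjacent_pairs f2 e2)[p [q [y [pqy -> ->]]]] inactive f_uniq S T FS FT.
have /setP ST := f_uniq _ _ (two_edges_pos pqy inactive FS)
  (two_edges_pos pqy inactive FT).
move: pqy; rewrite /= !inE !negb_or !andbT => /andP[/andP[pq py] qy].
apply/setP => t; have := ST t; rewrite !in_setD !in_set2 !in_put !negb_or.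
have [//|_] := eqVneq t p; have [//|ty] := eqVneq t y; have [->|//] := eqVneq t q.
move=> _; have := ST y; rewrite !in_setD !in_set2 !in_put eqxx !negb_or.
by rewrite eq_sym py eq_sym qy /= => /negb_inj.
Qed.

(** The edges [e2] and [e3] each meet [e1] in one vertex. If these vertices differ, [e1] is the
    middle of a path or, when the far ends coincide, a side of a triangle; if they agree, the edges
    form a star. *)
Lemma hub (es : seq {set N}) (e1 e2 e3 C : {set N}) :
    es =i [:: e1; e2; e3] -> uniq [:: e1; e2; e3] ->
    (forall e, e \in es -> #|e| = 2%N) ->
    #|e2 :\: e1| = 1%N -> #|e3 :\: e1| = 1%N ->
    (forall e : {set N}, #|e| = 2%N -> e \notin es -> forall T, F e T = 0) ->
    (forall e, e \in es -> uniquely_positive e) ->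
    0 < F e1 C ->
  edge_chain \/ edge_cycle.
Proof.
move=> esE es_uniq es2 d21 d31 inactive0 pos_uniq0 FC.
have {}es2 e : e \in [:: e1; e2; e3] -> #|e| = 2%N by rewrite -esE; apply: es2.
have inactive (e : {set N}) : #|e| = 2%N -> e \notin [:: e1; e2; e3] ->
  forall T, F e T = 0 by rewrite -esE; apply: inactive0.
have {inactive0} pos_uniq e : e \in [:: e1; e2; e3] -> uniquely_positive e.
  by rewrite -esE; apply: pos_uniq0.
have [c1 c2 c3] : [/\ #|e1| = 2%N, #|e2| = 2%N & #|e3| = 2%N].
  by split; apply: es2; rewrite !inE eqxx ?orbT.
have [p [q [y [pqy D1 D2]]]] := adjacent_pairs c1 c2 d21.
have [p' [q' [z [pqz D1' D3]]]] := adjacent_pairs c1 c3 d31.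
subst e1 e2 e3; move: (pqz) (pqy).
rewrite /= !inE !negb_or !andbT => /andP[/andP[pq' pz'] qz'] /andP[/andP[pq py] qy].
have : p' \in [set p; q] by rewrite D1' !inE eqxx.
have : q' \in [set p; q] by rewrite D1' !inE eqxx orbT.
rewrite !inE => /orP[]/eqP Dq /orP[]/eqP Dp; subst p' q'; rewrite ?eqxx // in pq'.
  left; apply: path_edge_chain pqy _ FC inactive.
  by rewrite /= !inE negb_or pq qz' pz'.
apply: star_hub inactive pos_uniq FC.
rewrite /= !inE !negb_or pq py pz' qy qz' !andbT /=.
by move: es_uniq; rewrite /= !inE negb_or andbT => /andP[_]; apply: contraNneq => ->.
Qed.

(** * Left sides with three terms *)

Variable s : seq ({set N} * {set N}).
Hypothesis s_uniq : uniq s.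
Hypothesis s_edge : forall t, t \in s -> #|t.1| = 2%N /\ t.2 \subset ~: t.1.
Hypothesis F_gt0E : forall e S : {set N},
  #|e| = 2%N -> (0 < F e S) = ((e, S :\: e) \in s).

Lemma F_term_gt0 t : t \in s -> 0 < F t.1 t.2.
Proof.
case: t => e C ts; have [/= e2 Ce] := s_edge ts.
by rewrite F_gt0E //; move: Ce; rewrite -disjoints_subset => /setDidPl->.
Qed.

Lemma F_inactive (e : {set N}) :
  #|e| = 2%N -> e \notin [seq t.1 | t <- s] -> forall T, F e T = 0.
Proof.
move=> e2 e_s; apply: F_le0_eq0 => // S; rewrite leNgt F_gt0E //.
by apply: contra e_s => /(map_f fst).
Qed.

(** If [f] is [e], the balance at [C1] has a single nonzero term. Otherwise [f] has one left term,
    so [adjacent_edge] makes [e] share exactly one vertex with it, and [two_edges_uniq] carries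
    uniqueness over to [e], contradicting [C1 != C2]. *)
Lemma repeated_edge (e f C1 C2 C3 : {set N}) :
  C1 != C2 -> s =i [:: (e, C1); (e, C2); (f, C3)] -> False.
Proof.
move=> C12 mem_s.
have [[e2 D1] [_ D2] [f2 D3]] : [/\ #|e| = 2%N /\ C1 \subset ~: e,
    #|e| = 2%N /\ C2 \subset ~: e & #|f| = 2%N /\ C3 \subset ~: f].
  split; [apply: (@s_edge (e, C1))|apply: (@s_edge (e, C2))|apply: (@s_edge (f, C3))];
  by rewrite mem_s !inE eqxx ?orbT.
have F1 : 0 < F e C1 by apply: (@F_term_gt0 (e, C1)); rewrite mem_s mem_head.
have F2 : 0 < F e C2 by apply: (@F_term_gt0 (e, C2)); rewrite mem_s !inE eqxx orbT.
have F3 : 0 < F f C3 by apply: (@F_term_gt0 (f, C3)); rewrite mem_s !inE eqxx !orbT.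
have inactive (g : {set N}) : #|g| = 2%N -> g \notin [:: f; e] -> forall T, F g T = 0.
  move=> g2 gef; apply: F_inactive => //; apply: contra gef.
  by case/mapP => t; rewrite mem_s !inE => /or3P[]/eqP-> ->; rewrite eqxx ?orbT.
have [fe|fe] := eqVneq f e.
  have : \sum_(g <- [:: e]) chi g C1 * F g C1 = 0.
    apply: balance_seq => // [g|g g2]; first by rewrite inE => /eqP->.
    by rewrite inE => ge; apply: inactive; rewrite // !inE fe orbb.
  rewrite big_seq1 => /eqP; rewrite mulf_eq0 (negPf (chi_neq0 _ _)) /=.
  by rewrite gt_eqF.
have f_uniq : uniquely_positive f.
  move=> S T; rewrite !F_gt0E // !mem_s !inE !xpair_eqE (negPf fe) /=.
  by rewrite !eqxx /= => /eqP-> /eqP->.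
have [g [S [g2 gf gS]]] := adjacent_edge f2 F3 (fun S FS => f_uniq _ _ FS F3).
have ge : g = e.
  apply: contraNeq gS => gNe; rewrite inactive // !inE negb_or gNe andbT.
  by apply: contra_eq_neq gf => ->; rewrite setDv cards0.
move: gf; rewrite ge => ef; have := two_edges_uniq e2 f2 ef inactive f_uniq F1 F2.
move: D1 D2; rewrite -!disjoints_subset => /setDidPl-> /setDidPl->.
by apply/eqP.
Qed.

(** The edges are distinct by [repeated_edge], and each shares exactly one vertex with another.
    Among three objects with a symmetric relation leaving none isolated, one is related to both
    others; it serves as the hub. *)
Lemma three_terms (e1 e2 e3 C1 C2 C3 : {set N}) :
  s = [:: (e1, C1); (e2, C2); (e3, C3)] -> edge_chain \/ edge_cycle.
Proof.
move=> Ds; move: (s_uniq).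
rewrite Ds /= !inE negb_or !xpair_eqE andbT => /andP[/andP[c12 c13] c23].
have [e12|n12] := eqVneq e1 e2.
  case: (@repeated_edge e1 e3 C1 C2 C3) => [|t]; first by move: c12; rewrite e12 eqxx.
  by rewrite Ds e12.
have [e13|n13] := eqVneq e1 e3.
  case: (@repeated_edge e1 e2 C1 C3 C2) => [|t]; first by move: c13; rewrite e13 eqxx.
  by rewrite Ds e13 !inE (orbC (t == (e2, _))).
have [e23|n23] := eqVneq e2 e3.
  case: (@repeated_edge e2 e1 C2 C3 C1) => [|t]; first by move: c23; rewrite e23 eqxx.
  by rewrite Ds e23 !inE orbC orbA.
have Des : [seq t.1 | t <- s] = [:: e1; e2; e3] by rewrite Ds.
have es_uniq : uniq [seq t.1 | t <- s] by rewrite Des /= !inE negb_or n12 n13 n23.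
have es2 e : e \in [seq t.1 | t <- s] -> #|e| = 2%N.
  by case/mapP => t /s_edge[t2 _] ->.
have pos_uniq e : e \in [seq t.1 | t <- s] -> uniquely_positive e.
  move=> es S T; rewrite !F_gt0E ?es2 // => eS eT.
  have [n21 n31 n32] : [/\ e2 != e1, e3 != e1 & e3 != e2] by split; rewrite eq_sym.
  move: eS eT; rewrite Ds !inE !xpair_eqE => /or3P[]/andP[/eqP-> /eqP->];
  by rewrite eqxx ?(negPf n12) ?(negPf n13) ?(negPf n23) ?(negPf n21)
    ?(negPf n31) ?(negPf n32) /= ?orbF => /eqP->.
have mem_es e : (e \in [seq t.1 | t <- s]) = [|| e == e1, e == e2 | e == e3].
  by rewrite Des !inE.
have adj e : e \in [seq t.1 | t <- s] ->
    exists2 e', e' \in [seq t.1 | t <- s] & #|e' :\: e| = 1%N.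
  move=> es; have /mapP[[e' C] eC /= De] := es; subst e'.
  have FC : 0 < F e C := F_term_gt0 eC.
  have [e' [S [e'2 e'e FS]]] :=
    adjacent_edge (es2 e es) FC (fun S FS => pos_uniq e es _ _ FS FC).
  by exists e' => //; apply: contraNT FS => /F_inactive->.
have adjC e e' : e \in [seq t.1 | t <- s] -> e' \in [seq t.1 | t <- s] ->
    #|e' :\: e| = 1%N -> #|e :\: e'| = 1%N.
  move=> /es2 c /es2 c'; have := cardsID e e'; have := cardsID e' e.
  by rewrite c c' setIC; lia.
have F1 : 0 < F e1 C1 by apply: (@F_term_gt0 (e1, C1)); rewrite Ds mem_head.
have F2 : 0 < F e2 C2 by apply: (@F_term_gt0 (e2, C2)); rewrite Ds !inE eqxx orbT.
have F3 : 0 < F e3 C3 by apply: (@F_term_gt0 (e3, C3)); rewrite Ds !inE eqxx !orbT.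
have hubE x y z C : [seq t.1 | t <- s] =i [:: x; y; z] -> uniq [:: x; y; z] ->
    0 < F x C -> #|y :\: x| = 1%N -> #|z :\: x| = 1%N -> edge_chain \/ edge_cycle.
  move=> esE xyz FC yx zx; exact: hub esE xyz es2 yx zx F_inactive pos_uniq FC.
have [m1 m2 m3] : [/\ e1 \in [seq t.1 | t <- s], e2 \in [seq t.1 | t <- s]
    & e3 \in [seq t.1 | t <- s]] by rewrite !mem_es !eqxx ?orbT.
have hub1 : #|e2 :\: e1| = 1%N -> #|e3 :\: e1| = 1%N -> edge_chain \/ edge_cycle.
  by apply: (hubE _ _ _ C1) => //; rewrite -Des.
have hub2 : #|e1 :\: e2| = 1%N -> #|e3 :\: e2| = 1%N -> edge_chain \/ edge_cycle.
  apply: (hubE _ _ _ C2) => //; first by move=> e; rewrite mem_es !inE orbCA.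
  by rewrite /= !inE negb_or eq_sym n12 n13 n23.
have hub3 : #|e1 :\: e3| = 1%N -> #|e2 :\: e3| = 1%N -> edge_chain \/ edge_cycle.
  apply: (hubE _ _ _ C3) => //; first by move=> e; rewrite mem_es !inE orbA orbC.
  by rewrite /= !inE negb_or (eq_sym e3) n13 (eq_sym e3) n23 n12.
have self (e : {set N}) : #|e :\: e| = 1%N -> edge_chain \/ edge_cycle.
  by rewrite setDv cards0.
have [e ] := adj e1 m1; rewrite mem_es => /or3P[]/eqP-> => [/self //||] a1.
- have [e'] := adj e3 m3; rewrite mem_es => /or3P[]/eqP-> => [||/self //] a3.
    by apply: hub1 => //; apply: adjC a3.
  by apply: hub2; [apply: adjC a1|apply: adjC a3].
- have [e'] := adj e2 m2; rewrite mem_es => /or3P[]/eqP-> => [|/self //|] a2.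
    by apply: hub1 => //; apply: adjC a2.
  by apply: hub3; [apply: adjC a1|apply: adjC a2].
Qed.

End Balance.

(** * From formal relations to signed weights *)

Section Weights.

Variables (R : realType) (N : finType).

Notation pair := ({set N} * {set N})%type.

Definition imset (t : pair) : {ffun {set N} -> R^o} :=
  [ffun S => chi R t.1 S * (S :\: t.1 == t.2)%:R].

(** Both sides live on the four sets that agree with [C] off [a] and [b], where the product of signs
    is 1 if both or neither of [a], [b] belong to the set, and -1 otherwise. *)
Lemma elem_imsetE (a b : N) (C : {set N}) :
  a != b -> C \subset ~: [set a; b] -> elem_imset R a b C = imset ([set a; b], C).
Proof.
move=> ab; rewrite -disjoints_subset => dis; apply/ffunP => S; rewrite !ffunE /= chi2 //.
have aC : a \in C = false by rewrite (disjointFl dis) // !inE eqxx.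
have bC : b \in C = false by rewrite (disjointFl dis) // !inE eqxx orbT.
have split_eq (T : {set N}) : T :\: [set a; b] = C ->
    (S == T) = [&& (a \in S) == (a \in T), (b \in S) == (b \in T)
                 & S :\: [set a; b] == C].
  move=> <-; apply/eqP/and3P => [->//|[/eqP aST /eqP bST /eqP/setP ST]].
  apply/setP => x; have := ST x; rewrite !in_setD in_set2.
  by have [->//|_] := eqVneq x a; have [->//|_] := eqVneq x b.
have CD : C :\: [set a; b] = C by apply/setDidPl.
rewrite !split_eq ?setDUl ?CD //; try by apply/setP => x; rewrite !inE; do 2 case: eqP.
rewrite !inE !eqxx aC bC (eq_sym b a) (negPf ab) /=.
case: (a \in S); case: (b \in S); case: (_ == C) => /=; lra.
Qed.

Definition is_edge_pair (t : pair) : Prop := #|t.1| = 2%N /\ t.2 \subset ~: t.1.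

Lemma edge_pairK (t : pair) : is_edge_pair t -> t.2 :\: t.1 = t.2.
Proof. by case=> _; rewrite -disjoints_subset => /setDidPl. Qed.

Definition weighted_side (w : seq (R * pair)) : side R N :=
  [seq (t.1, imset t.2) | t <- w].

Lemma elementary_side (s : side R N) : (forall t, t \in s -> elementary t.2) ->
  exists w, s = weighted_side w /\ forall t, t \in w -> is_edge_pair t.2.
Proof.
elim: s => [|[c u] s IH] elem_s; first by exists [::].
have [w [-> w_edge]] := IH (fun t ts => elem_s t (mem_behead (s := _ :: _) ts)).
have [/= a [b [C [ab Cab ->]]]] := elem_s _ (mem_head _ _).
exists ((c, ([set a; b], C)) :: w); split; first by rewrite /= elem_imsetE.
by move=> t; rewrite inE => /orP[/eqP->|/w_edge//]; split; rewrite //= cards2 ab.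
Qed.

(** Reading the bottom as [S :\: e] extends the weight to every [S] and makes it independent of the
    coordinates in [e]. *)
Definition weight (w : seq (R * pair)) (e S : {set N}) : R :=
  \sum_(t <- w) t.1 * (t.2 == (e, S :\: e))%:R.

Lemma weight_base w (e S : {set N}) : weight w e (S :\: e) = weight w e S.
Proof. by rewrite /weight setDDl setUid. Qed.

(** This regroups the terms of a side by their edges, turning an equality of sides into the balance
    condition. *)
Lemma sum_weight w (S : {set N}) : (forall t, t \in w -> is_edge_pair t.2) ->
  \sum_(e : {set N} | #|e| == 2) chi R e S * weight w e S =
  side_sum (weighted_side w) S.
Proof.
move=> w_edge; rewrite /side_sum big_map sum_ffunE.
under eq_bigr do rewrite mulr_sumr.
rewrite exchange_big /=; apply: eq_big_seq => -[c [e C]] /w_edge[/= e2 _].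
rewrite (bigD1 e) ?e2 //= big1 => [|e' /andP[_ e'e]]; last first.
  by rewrite xpair_eqE eq_sym (negPf e'e) !mulr0.
by rewrite !ffunE /= xpair_eqE eqxx addr0 eq_sym mulrCA.
Qed.

Lemma weight_eq0 w (e S : {set N}) :
  (e, S :\: e) \notin [seq t.2 | t <- w] -> weight w e S = 0.
Proof.
move=> eS; apply: big1_seq => t /andP[_ tw].
by case: eqP => [t2|_]; rewrite ?mulr0 //; case/negP: eS; rewrite -t2 map_f.
Qed.

Lemma weightE w (t : R * pair) : uniq [seq t.2 | t <- w] -> t \in w ->
  is_edge_pair t.2 -> weight w t.2.1 t.2.2 = t.1.
Proof.
move=> w_uniq tw t_edge; elim: w w_uniq tw => //= u w IH /andP[uw w_uniq].
rewrite inE /weight big_cons edge_pairK // -surjective_pairing.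
case/orP => [/eqP ->|tw].
  rewrite eqxx mulr1 -[RHS]addr0; congr (_ + _).
  by apply: big1_seq => x /andP[_ xw]; case: eqP => [xu|_]; rewrite ?mulr0 //;
    case/negP: uw; rewrite -xu map_f.
have /negPf-> : u.2 != t.2 by apply: contraNneq uw => ->; apply: map_f.
rewrite mulr0 add0r -[RHS]IH //; apply: eq_bigr => x _.
by rewrite edge_pairK // -surjective_pairing.
Qed.

Lemma weight_gt0 w (e S : {set N}) : (forall t, t \in w -> 0 < t.1) ->
  (e, S :\: e) \in [seq t.2 | t <- w] -> 0 < weight w e S.
Proof.
move=> w_gt0 /mapP[t tw t2]; rewrite /weight (perm_big _ (perm_to_rem tw)) big_cons.
rewrite -t2 eqxx mulr1 ltr_wpDr ?w_gt0 // big_seq sumr_ge0 // => u /mem_rem uw.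
by rewrite mulr_ge0 ?ler0n ?ltW ?w_gt0.
Qed.

Lemma cyclic_edge_pair (a b1 b2 b3 : N) (C : {set N}) :
    uniq [:: a; b1; b2; b3] -> C \subset ~: [set a; b1; b2; b3] ->
  forall t, t \in cyclic_lhs a b1 b2 b3 C ++ cyclic_rhs a b1 b2 b3 C ->
    is_edge_pair t.
Proof.
move=> ab_uniq; rewrite -disjoints_subset => dis.
have [aC [b1C b2C b3C]] : a \in C = false /\
    [/\ b1 \in C = false, b2 \in C = false & b3 \in C = false].
  by split; [|split]; rewrite (disjointFl dis) // !inE eqxx ?orbT.
move: ab_uniq; rewrite /= !inE !negb_or !andbT.
case/and3P=> /and3P[n1 n2 n3] /andP[n12 n13] n23 t.
have edge x y : a != x -> a != y -> x != y -> x \in C = false ->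
    is_edge_pair ([set a; x], y |: C).
  move=> ax ay xy xC; split; rewrite /= ?cards2 ?ax // -disjoints_subset disjoint_sym.
  rewrite disjoints_subset; apply/subsetP => z; rewrite !inE => /orP[]/eqP->.
    by rewrite (negPf ay) aC.
  by rewrite (negPf xy) xC.
by rewrite !inE => /or4P[/eqP->|/eqP->|/eqP->|/or3P[]/eqP->]; apply: edge; rewrite // eq_sym.
Qed.

Lemma cyclic_uniq (a b1 b2 b3 : N) (C : {set N}) : uniq [:: a; b1; b2; b3] ->
  uniq (cyclic_lhs a b1 b2 b3 C) /\ uniq (cyclic_rhs a b1 b2 b3 C).
Proof.
rewrite /= !inE !negb_or !andbT => /and3P[/and3P[n1 n2 n3] /andP[n12 n13] n23].
have ne x y (X Y : {set N}) : a != x -> x != y ->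
    (([set a; x], X) == ([set a; y], Y)) = false.
  move=> ax xy; rewrite xpair_eqE; apply: contraNF xy => /andP[/eqP/setP/(_ x) + _].
  by rewrite !inE eqxx orbT eq_sym (negPf ax) => /esym/eqP->.
by rewrite !ne // eq_sym.
Qed.

Lemma cyclic_relationE (a b1 b2 b3 : N) (C : {set N}) (c : R) :
    uniq [:: a; b1; b2; b3] -> C \subset ~: [set a; b1; b2; b3] ->
  scale_relation c (cyclic_relation R a b1 b2 b3 C) =
  FormalRelation [seq (c, imset t) | t <- cyclic_lhs a b1 b2 b3 C]
                 [seq (c, imset t) | t <- cyclic_rhs a b1 b2 b3 C].
Proof.
move=> ab_uniq Cab; have edges := cyclic_edge_pair ab_uniq Cab.
have E x y :
    ([set a; x], y |: C) \in cyclic_lhs a b1 b2 b3 C ++ cyclic_rhs a b1 b2 b3 C ->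
    elem_imset R a x (y |: C) = imset ([set a; x], y |: C).
  by move=> /edges[/= c2 ?]; rewrite elem_imsetE //; move: c2; rewrite cards2; case: eqP.
rewrite /scale_relation /scale_side /= mulr1.
by rewrite !E // !inE eqxx ?orbT.
Qed.

End Weights.

(** * The two alternatives for formal relations *)

Theorem theorem6p3 (R : realType) (N : finType) (m : nat)
    (u1 u2 u3 : {ffun {set N} -> R^o}) (v : 'I_m -> {ffun {set N} -> R^o})
    (alpha1 alpha2 alpha3 : nat) (beta : 'I_m -> nat)
    (star : formal_relation R N)
    (star_def : star = FormalRelation
       [:: (alpha1%:R, u1); (alpha2%:R, u2); (alpha3%:R, u3)]
       [seq ((beta j)%:R, v j) | j <- enum 'I_m])
    (m_ge1 : (1 <= m)%N)
    (alpha_gt0 : [/\ (0 < alpha1)%N, (0 < alpha2)%N & (0 < alpha3)%N])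
    (beta_gt0 : forall j, (0 < beta j)%N)
    (star_rel : is_relation star) :
  [/\ m = 3%N,
      [/\ alpha1 = alpha2, alpha2 = alpha3 & forall j, beta j = alpha3] &
      exists (a b1 b2 b3 : N) (C : {set N}) (c : R),
        [/\ uniq [:: a; b1; b2; b3], C \subset ~: [set a; b1; b2; b3], 0 < c &
            eq_up_to_order star (scale_relation c (cyclic_relation R a b1 b2 b3 C))]]
  \/
  exists (a b1 b2 : N) (C : {set N}) (c : R),
    [/\ uniq [:: a; b1; b2], C \subset ~: [set a; b1; b2], 0 < c &
        contains star (scale_relation c (exchange_relation R a b1 b2 C))].
Proof.
have [coef_gt0 elem_star star_uniq sum_eq] := star_rel.
have [wl [Dl wl_edge]] : exists w, lhs star = weighted_side w /\
    forall t, t \in w -> is_edge_pair t.2.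
  by apply: elementary_side => t ts; apply: elem_star; rewrite mem_cat ts.
have [wr [Dr wr_edge]] : exists w, rhs star = weighted_side w /\
    forall t, t \in w -> is_edge_pair t.2.
  by apply: elementary_side => t ts; apply: elem_star; rewrite mem_cat ts orbT.
pose sl := [seq t.2 | t <- wl]; pose sr := [seq t.2 | t <- wr].
have imsetsE w : imsets (weighted_side w) = [seq imset R t | t <- [seq t.2 | t <- w]].
  by rewrite /imsets /weighted_side -!map_comp.
have wl_gt0 t : t \in wl -> 0 < t.1.
  by move=> tw; apply: (coef_gt0 (t.1, imset R t.2)); rewrite mem_cat Dl map_f.
have wr_gt0 t : t \in wr -> 0 < t.1.
  move=> tw; apply: (coef_gt0 (t.1, imset R t.2)); rewrite mem_cat Dr.
  by rewrite (map_f (fun t => (t.1, imset R t.2)) tw) orbT.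
(* Distinct imsets come from distinct pairs, so left and right weights never cancel in the
   difference [F]. *)
have : uniq (sl ++ sr).
  by move: star_uniq; rewrite Dl Dr !imsetsE -map_cat => /map_uniq.
rewrite cat_uniq => /and3P[sl_uniq sl_sr sr_uniq].
have disj t : t \in sr -> t \notin sl by move=> tr; apply: (hasPn sl_sr).
pose F e S := weight wl e S - weight wr e S.
have F_base e S : F e (S :\: e) = F e S by rewrite /F !weight_base.
have F_balance S : \sum_(e : {set N} | #|e| == 2) chi R e S * F e S = 0.
  under eq_bigr do rewrite mulrBr.
  by rewrite sumrB !sum_weight // -Dl -Dr sum_eq subrr.
have F_neg t : t \in sr -> F t.1 t.2 < 0.
  move=> tr; have /mapP[u uw Dt] := tr.
  have t_edge : is_edge_pair t by rewrite Dt; apply: wr_edge.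
  rewrite /F weight_eq0 ?edge_pairK -?surjective_pairing ?disj // sub0r oppr_lt0.
  by apply: weight_gt0 => //; rewrite edge_pairK // -surjective_pairing.
have F_wl t : t \in wl -> F t.2.1 t.2.2 = t.1.
  move=> tw; have tl : t.2 \in sl by apply: map_f.
  rewrite /F (weightE sl_uniq tw (wl_edge _ tw)) weight_eq0 ?subr0 // edge_pairK;
    last exact: wl_edge.
  by rewrite -surjective_pairing; apply/negP => /disj; rewrite tl.
have F_wr t : t \in wr -> F t.2.1 t.2.2 = - t.1.
  move=> tw; have tr : t.2 \in sr by apply: map_f.
  rewrite /F (weightE sr_uniq tw (wr_edge _ tw)) weight_eq0 ?sub0r // edge_pairK;
    last exact: wr_edge.
  by rewrite -surjective_pairing disj.
have F_gt0E (e S : {set N}) : #|e| = 2%N -> (0 < F e S) = ((e, S :\: e) \in sl).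
  move=> _; have [/= eSl|eSl] := boolP (_ \in sl).
    rewrite /F [X in _ - X]weight_eq0 ?subr0 ?weight_gt0 //.
    by apply/negP => /disj; rewrite eSl.
  rewrite /F weight_eq0 // sub0r oppr_gt0; apply/negbTE; rewrite -leNgt.
  rewrite /weight big_seq sumr_ge0 // => t tw.
  by rewrite mulr_ge0 ?ler0n ?ltW ?wr_gt0.
have sl_edge t : t \in sl -> is_edge_pair t by case/mapP => u uw ->; apply: wl_edge.
have sr_edge t : t \in sr -> is_edge_pair t by case/mapP => u uw ->; apply: wr_edge.
have [] : edge_chain F \/ edge_cycle F.
  have : size sl = 3%N.
    rewrite size_map -(size_map (fun t => (t.1, imset R t.2))).
    by rewrite -/(weighted_side wl) -Dl star_def.
  case Dsl : sl => [|[e1 C1] [|[e2 C2] [|[e3 C3] []]]] //= _.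
  exact: (@three_terms _ _ _ F_base F_balance sl sl_uniq sl_edge F_gt0E
    _ _ _ _ _ _ Dsl).
- move=> [a [b [b' [C [abb' Cabb' F1 F2]]]]]; right.
  (* Containment compares imsets only, so the multiple 1 serves; the exchange pair lies on the
     left. *)
  exists a, b, b', C, 1; split=> //; left.
  move: abb'; rewrite /= !inE negb_or andbT => /andP[/andP[ab ab'] bb'].
  have pos_lhs (x y : N) (X : {set N}) :
      x != y -> X \subset ~: [set x; y] -> 0 < F [set x; y] X ->
      elem_imset R x y X \in imsets (lhs star).
    move=> xy Xxy; rewrite F_gt0E ?cards2 ?xy // elem_imsetE //.
    rewrite -disjoints_subset in Xxy; have /setDidPl-> := Xxy.
    by rewrite Dl imsetsE; apply: map_f.
  have Csub (A : {set N}) : A \subset [set a; b; b'] -> C \subset ~: A.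
    by move=> Aabb'; rewrite (subset_trans Cabb') // setCS.
  move=> u; rewrite !inE => /orP[]/eqP->; apply: pos_lhs => //.
    by rewrite Csub // subsetUl.
  rewrite subUset sub1set !inE negb_or (eq_sym b a) ab bb' Csub //.
  by apply/subsetP => x; rewrite !inE => /orP[]->; rewrite ?orbT.
move=> [a [b1 [b2 [b3 [C [c [[ab_uniq Cab c_gt0] [F_lhs F_rhs F_supp]]]]]]]]; left.
have edges := cyclic_edge_pair ab_uniq Cab.
have [lhs_uniq rhs_uniq] := cyclic_uniq C ab_uniq.
have F_t t : is_edge_pair t -> F t.1 t.2 != 0 ->
    t \in cyclic_lhs a b1 b2 b3 C ++ cyclic_rhs a b1 b2 b3 C.
  by move=> t_edge /F_supp; rewrite edge_pairK // -surjective_pairing; apply; case: t_edge.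
have sl_pos t : t \in sl -> 0 < F t.1 t.2.
  move=> tl; have t_edge := sl_edge t tl; rewrite F_gt0E; last by case: t_edge.
  by rewrite edge_pairK // -surjective_pairing.
(* The left pairs are those with positive [F]. As [F] is supported on the cyclic pairs, with values
   [c] and [- c], its sign separates the two sides. *)
have sl_perm : perm_eq sl (cyclic_lhs a b1 b2 b3 C).
  apply: uniq_perm => // t; apply/idP/idP => [tl|tc].
    have := F_t t (sl_edge t tl) (lt0r_neq0 (sl_pos t tl)); rewrite mem_cat.
    by case/orP => // /F_rhs Ft; have := sl_pos t tl; rewrite Ft oppr_gt0 ltNge ltW.
  have t_edge : is_edge_pair t by apply: edges; rewrite mem_cat tc.
  have <- : (0 < F t.1 t.2) = (t \in sl).
    by rewrite F_gt0E ?edge_pairK -?surjective_pairing //; case: t_edge.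
  by rewrite F_lhs.
have sr_perm : perm_eq sr (cyclic_rhs a b1 b2 b3 C).
  apply: uniq_perm => // t; apply/idP/idP => [tr|tc].
    have := F_t t (sr_edge t tr) (ltr0_neq0 (F_neg t tr)); rewrite mem_cat.
    by case/orP => // /F_lhs Ft; have := F_neg t tr; rewrite Ft ltNge ltW.
  have t_edge : is_edge_pair t by apply: edges; rewrite mem_cat tc orbT.
  (* A pair absent from the right would have a sum of nonnegative left weights as its value, which
     cannot be [- c]. *)
  apply: contraTT c_gt0 => tr; rewrite -leNgt -oppr_ge0 -(F_rhs t tc) /F.
  rewrite [X in _ - X]weight_eq0 ?edge_pairK -?surjective_pairing // subr0.
  rewrite /weight big_seq sumr_ge0 // => u uw.
  by rewrite mulr_ge0 ?ler0n ?ltW ?wl_gt0.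
have wl_c t : t \in wl -> t.1 = c.
  move=> tw; rewrite -F_wl // F_lhs // -(perm_mem sl_perm); exact: map_f.
have wr_c t : t \in wr -> t.1 = c.
  move=> tw; apply: oppr_inj; rewrite -F_wr // F_rhs // -(perm_mem sr_perm); exact: map_f.
have side_c w : (forall t, t \in w -> t.1 = c) ->
    weighted_side w = [seq (c, imset R t) | t <- [seq t.2 | t <- w]].
  by move=> w_c; rewrite -map_comp; apply/eq_in_map => t /w_c /= ->.
(* The number of right terms is read off from the permutation of [sr]. *)
have m3 : m = 3%N.
  have := perm_size sr_perm; rewrite size_map -(size_map (fun t => (t.1, imset R t.2))).
  by rewrite -/(weighted_side wr) -Dr star_def /= size_map size_enum_ord.
have coef_c t : t \in lhs star ++ rhs star -> t.1 = c.
  rewrite mem_cat Dl Dr => /orP[] /mapP[u uw ->] /=; [exact: wl_c|exact: wr_c].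
have nat_inj (n n' : nat) : n%:R = c -> n'%:R = c -> n = n'.
  by move=> <- /eqP; rewrite eqr_nat => /eqP.
have [a1c a2c a3c] : [/\ alpha1%:R = c, alpha2%:R = c & alpha3%:R = c].
  split; [apply: (coef_c (_, u1))|apply: (coef_c (_, u2))|apply: (coef_c (_, u3))];
  by rewrite star_def !inE eqxx ?orbT.
split=> //.
  split; [exact: nat_inj a2c|exact: nat_inj a3c|move=> j].
  apply: nat_inj a3c; apply: (coef_c (_, v j)); rewrite mem_cat star_def /= orbC.
  by rewrite (map_f (fun j => ((beta j)%:R, v j))) ?mem_enum.
exists a, b1, b2, b3, C, c; split=> //; rewrite cyclic_relationE //; split.
  rewrite Dl side_c //; exact: perm_map sl_perm.
rewrite Dr side_c //; exact: perm_map sr_perm.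
Qed.
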